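(* If a topological space $X$ has a rank $3$-diagonal, then $$|X|\le wL(X)^{\omega}.$$
   Context: The weak Lindelöf number $wL(X)$ is the least cardinal $\kappa$ such that every open cover of $X$ has a subfamily of cardinality at most $\kappa$ whose union is dense in $X$. For a family $\mathcal{U}$ of subsets of $X$ and $A\subseteq X$, put $\mathrm{St}(A,\mathcal{U})=\bigcup\{U\in\mathcal{U}:A\cap U\ne\emptyset\}$, $\mathrm{St}^0(A,\mathcal{U})=A$, $\mathrm{St}^{n+1}(A,\mathcal{U})=\mathrm{St}(\mathrm{St}^n(A,\mathcal{U}),\mathcal{U})$ and $\mathrm{St}^n(x,\mathcal{U})=\mathrm{St}^n(\{x\},\mathcal{U})$. $X$ has a rank $3$-diagonal if there is a sequence $\{\mathcal{U}_n:n<\omega\}$ of open covers of $X$ such that for all $x\ne y$ in $X$ there is $n<\omega$ with $y\notin\mathrm{St}^3(x,\mathcal{U}_n)$. *)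

(* Defs.v *)
From mathcomp Require Import all_boot.
From mathcomp Require Import boolp classical_sets functions cardinality.
From mathcomp Require Import topology.

Set Implicit Arguments.
Unset Strict Implicit.
Unset Printing Implicit Defensive.

Local Open Scope classical_set_scope.
Local Open Scope card_scope.

Definition open_cover (X : topologicalType) (U : set (set X)) : Prop :=
  U `<=` open /\ \bigcup_(A in U) A = [set: X].

Definition star (X : Type) (U : set (set X)) (A : set X) : set X :=
  \bigcup_(B in [set B | U B /\ A `&` B !=set0]) B.

Definition star_iter (X : Type) (n : nat) (A : set X) (U : set (set X)) :
  set X := iter n (star U) A.

Definition rank_diagonal (X : topologicalType) (k : nat) : Prop :=
  exists U : nat -> set (set X),
    (forall n, open_cover (U n)) /\
    (forall x y : X, x <> y -> exists n, ~ star_iter k [set x] (U n) y).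

(* Cardinals are represented by sets, possibly of different types, and compared
   through injections, i.e. through [#<=]. *)
Definition weak_lindelof_le (X : topologicalType) (T : Type) (K : set T) :
    Prop :=
  forall U : set (set X), open_cover U ->
    exists V : set (set X), [/\ V `<=` U, V #<= K & dense (\bigcup_(A in V) A)].

Definition is_weak_lindelof_number (X : topologicalType) (T : Type)
    (K : set T) : Prop :=
  weak_lindelof_le X K /\
  (forall (T' : Type) (K' : set T'), weak_lindelof_le X K' -> K #<= K').

(* The least cardinal is at most that of X, hence is represented by a subset of
   X; [weak_lindelof_numberP] shows that the default value of [get] is never
   used. *)
Definition weak_lindelof_number (X : topologicalType) : set X :=
  get (fun K : set X => is_weak_lindelof_number X K).
Arguments weak_lindelof_number : clear implicits.

Lemma card_least (T : Type) (P : set (set T)) : P !=set0 ->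
  exists2 A, P A & forall B, P B -> A #<= B.
Proof.
move=> [A0 PA0].
pose Q : set (set (set T -> T)) := [set F |
  (forall f B, F f -> P B -> B (f B)) /\
  (forall f g B, F f -> F g -> P B -> f B = g B -> f = g)].
have [|F [[FP Finj] Fmax]] := @Zorn_bigcup (set T -> T) Q.
  move=> C CQ Ctot; split=> [f B [F CF Ff]|f g B [F CF Ff] [G CG Gg]].
    by have [+ _] := CQ _ CF; apply.
  have [FG|GF] := Ctot _ _ CF CG.
    by have [_ +] := CQ _ CG; apply => //; exact: FG.
  by have [_ +] := CQ _ CF; apply => //; exact: GF.
have [A PA AF] : exists2 A, P A & A `<=` (fun f => f A) @` F.
  apply: contrapT => nA.
  have missed B : P B -> exists2 b, B b & forall f, F f -> f B <> b.
    move=> PB; apply: contrapT => nb; apply: nA; exists B => // b Bb.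
    apply: contrapT => nf; apply: nb; exists b => // f Ff fb.
    by apply: nf; exists f.
  have [t0 _ _] := missed _ PA0.
  have /choice[g gP] : forall B, exists b,
      P B -> B b /\ forall f, F f -> f B <> b.
    move=> B; have [/missed[b Bb bF]|nPB] := pselect (P B); first by exists b.
    by exists t0.
  have nFg : ~ F g by have [_ gF] := gP _ PA0; move=> /gF.
  apply: (Fmax (F `|` [set g])).
  - by split=> [f Ff|/(_ g (or_intror erefl))//]; left.
  - split=> [f B [Ff|->] PB|f h B [Ff|->] [Fh|->] PB //].
    + exact: (FP _ B).
    + by have [] := gP _ PB.
    + by move=> e; exact: (Finj _ _ B).
    + by have [_ /(_ _ Ff)] := gP _ PB.
    + by have [_ /(_ _ Fh) nh] := gP _ PB; move=> /esym /nh.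
exists A => // B PB.
apply: (@card_le_trans _ _ _ F).
  apply: (card_le_trans (subset_card_le AF)); exact: card_image_le.
have Binj : {in F &, injective (fun f : set T -> T => f B)}.
  by move=> f h /set_mem Ff /set_mem Fh; exact: (Finj _ _ B).
rewrite -(card_le_eql (inj_card_eq Binj)); apply: subset_card_le.
by move=> _ [f Ff <-]; exact: (FP _ B).
Qed.

Lemma card_le_comparable (T T' : Type) (A : set T) (B : set T') :
  A #<= B \/ B #<= A.
Proof.
have eA : (@inl T T') @` A #= A by apply: inj_card_eq => x y _ _ [].
have eB : (@inr T T') @` B #= B by apply: inj_card_eq => x y _ _ [].
have [|C CP Cle] := @card_least _ [set inl @` A; inr @` B].
  by exists (inl @` A); left.
case: CP Cle => -> Cle; [left|right].
  by rewrite -(card_le_eql eA) -(card_le_eqr eB); apply: Cle; right.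
by rewrite -(card_le_eqr eA) -(card_le_eql eB); apply: Cle; left.
Qed.

Lemma weak_lindelof_numberP (X : topologicalType) :
  is_weak_lindelof_number X (weak_lindelof_number X).
Proof.
suff : exists K : set X, is_weak_lindelof_number X K by move=> /getPex.
have [|A WA Amin] := @card_least _ [set K : set X | weak_lindelof_le X K].
  exists [set: X] => U [Uo Uc].
  have /choice[f fP] : forall x, exists B, U B /\ B x.
    by move=> x; have : [set: X] x by []; rewrite -Uc => -[B UB Bx]; exists B.
  exists (range f); split.
  - by move=> _ [x _ <-]; case: (fP x).
  - exact: card_image_le.
  - move=> O [x Ox] _; exists x; split=> //.
    by exists (f x); [exists x|case: (fP x)].
exists A; split=> // T' K' WK'.
have [KX|] := card_le_comparable K' [set: X]; last first.
  by apply: card_le_trans; exact: card_leT.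
have /card_subP[B BK' _] := KX.
rewrite -(card_le_eqr BK'); apply: Amin => U Uc.
have [V [VU VK Vd]] := WK' U Uc.
by exists V; split=> //; rewrite (card_le_eqr BK').
Qed.

(* Main.v *)
(** Each cover [U n] contains a family [V n] of at most wL(X) sets with dense
    union.  Assign to [x] a sequence of members of [V n], the [n]-th one meeting a
    member of [U n] that contains [x].  Two points with the same sequence lie in
    each other's third star with respect to every [U n], hence coincide. *)

Require Import Defs.
From mathcomp Require Import all_boot.
From mathcomp Require Import boolp classical_sets functions cardinality.
From mathcomp Require Import topology.

Local Open Scope classical_set_scope.
Local Open Scope card_scope.

(** A member of [U] containing [x] is open and nonempty, so it meets the dense union. *)
Lemma dense_meets_star (X : topologicalType) (U V : set (set X)) (x : X) :
  open_cover U -> dense (\bigcup_(A in V) A) ->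
  exists2 A, V A & A `&` star U [set x] !=set0.
Proof.
move=> [Uo Uc] Vd; have : [set: X] x by [].
rewrite -Uc => -[B UB Bx].
have [z [Bz [A VA Az]]] := Vd B (ex_intro _ x Bx) (Uo _ UB).
by exists A => //; exists z; split=> //; exists B => //; split=> //; exists x.
Qed.

(** Three links lead from [x] to [y]: a member of [U] through [x], then [A], then a member through
    [y]. *)
Lemma star_iter3 (X : Type) (U : set (set X)) (A : set X) (x y : X) :
  U A -> A `&` star U [set x] !=set0 -> A `&` star U [set y] !=set0 ->
  star_iter 3 [set x] U y.
Proof.
move=> UA [z [Az zx]] [w [Aw [B [UB [_ [-> By]]] Bw]]].
exists B => //; split=> //; exists w; split=> //.
by exists A => //; split=> //; exists z.
Qed.

Theorem proposition4p7 (X : topologicalType) :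
  rank_diagonal X 3 -> [set: X] #<= [set: nat -> weak_lindelof_number X].
Proof.
move=> [U [Uc Usep]].
have [wLX _] := weak_lindelof_numberP X.
have /choice[h hP] n : exists h : X -> weak_lindelof_number X,
    forall x y, h x = h y -> star_iter 3 [set x] (U n) y.
  have [V [VU /card_leP[g] Vd]] := wLX (U n) (Uc n).
  have /choice[f fP] (x : X) : exists A : V,
      val A `&` star (U n) [set x] !=set0.
    have [A VA Ax] := @dense_meets_star X _ _ x (Uc n) Vd.
    by exists (exist _ A (mem_set VA)).
  have ginj A B : g A = g B -> A = B by apply: inj; rewrite in_setT.
  (* [f] picks a member of [V] meeting the star of [x], and [g] codes it injectively: equal codes
     give one common middle link. *)
  exists (g \o f) => x y /ginj fxy.
  apply: (@star_iter3 _ _ (val (f x))) => //; last by rewrite fxy.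
  by apply: VU; exact/set_mem/(valP (f x)).
pose seq_of x n := h n x.
have seq_inj : {in [set: X] &, injective seq_of}.
  move=> x y _ _ exy; apply: contrapT => /Usep[n]; apply.
  by apply: hP; rewrite -[h n x]/(seq_of x n) exy.
rewrite -(card_le_eql (inj_card_eq seq_inj)); exact: card_leT.
Qed.
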